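(* Let $\eta\in\{123,321\}$. For $k\ge2$ define $\tau^*(\eta)\in S_k^{\text{av}(\eta)}$ by $\tau^*(\eta)=k\cdots1$ if $\eta=123$, and $\tau^*(\eta)=1\cdots k$ if $\eta=321$. In the statements below, $k\ge2$ is a fixed integer, while $(k_n)$ denotes a sequence of integers with $2\le k_n\le n$. (i) For fixed $k$ and $\tau\in S_k^{\text{av}(\eta)}$ with $\tau\neq\tau^*(\eta)$, $$\lim_{n\to\infty}E_n^{\text{av}(\eta)}N_n^{(k;\tau)}=\frac1{4^{k-1}};$$ and if $k_n=o(n)$ and $\tau=\tau_n\in S_{k_n}^{\text{av}(\eta)}$ with $\tau\neq\tau^*(\eta)$, then $$E_n^{\text{av}(\eta)}N_n^{(k_n;\tau)}\sim\frac1{4^{k_n-1}}\quad\text{as } n\to\infty.$$ (ii) For $\tau=\tau^*(\eta)$, $$\lim_{n\to\infty}\frac1nE_n^{\text{av}(\eta)}N_n^{(k;\tau)}=\frac1{4^{k-1}};\qquad E_n^{\text{av}(\eta)}N_n^{(k_n;\tau)}\sim\frac n{4^{k_n-1}}\ \text{ as } n\to\infty,\ \text{if } k_n=o(n)$$ (where in the second relation $\tau=\tau^*(\eta)\in S_{k_n}^{\text{av}(\eta)}$). (iii) $$\lim_{n\to\infty}\frac1nE_n^{\text{av}(\eta)}N_n^{(k)}=\frac1{4^{k-1}};\qquad E_n^{\text{av}(\eta)}N_n^{(k_n)}\sim\frac n{4^{k_n-1}}+\frac4{\sqrt\pi\,k_n^{3/2}}\ \text{ as } n\to\infty,\ \text{if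 } \lim_{n\to\infty}k_n=\infty\ \text{and } k_n=o(n).$$
   Context: $S_n$ is the set of permutations $\sigma=\sigma_1\cdots\sigma_n$ of $[n]=\{1,\dots,n\}$. A permutation $\sigma\in S_n$ contains $\eta\in S_m$ ($m\le n$) as a pattern if there are indices $1\le i_1<\cdots<i_m\le n$ such that for all $1\le j,k\le m$, $\sigma_{i_j}<\sigma_{i_k}$ if and only if $\eta_j<\eta_k$; otherwise $\sigma$ avoids $\eta$. $S_n^{\text{av}(\eta)}$ is the set of $\sigma\in S_n$ avoiding $\eta$ (and $S_n^{\text{av}(\eta)}=S_n$ if $n<m$). $P_n^{\text{av}(\eta)}$ is the uniform probability measure on $S_n^{\text{av}(\eta)}$ and $E_n^{\text{av}(\eta)}$ is the corresponding expectation. For $2\le k\le n$, $\tau\in S_k^{\text{av}(\eta)}$ and $\sigma\in S_n^{\text{av}(\eta)}$, $N_n^{(k;\tau)}(\sigma)$ is the number of pairs $(l,m)$ with $1\le l,m\le n-k+1$ such that $\{l,l+1,\dots,l+k-1\}=\{\sigma_m,\dots,\sigma_{m+k-1}\}$ and $\tau_i=\sigma_{m+i-1}-(l-1)$ for $i=1,\dots,k$. Further, $N_n^{(k)}(\sigma)=\sum_{\tau\in S_k^{\text{av}(\eta)}}N_n^{(k;\tau)}(\sigma)$. $a_n\sim b_n$ means $a_n/b_n\to1$. *)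

(* Defs.v *)
(* 'S_n is the type of permutations of 'I_n = {0, ..., n-1}: positions and values
   are those of one-line notation shifted by 1. *)
From HB Require Import structures.
From mathcomp Require Import all_boot all_order all_algebra all_fingroup.
From mathcomp Require Import all_classical all_reals all_analysis.
Set Implicit Arguments.
Unset Strict Implicit.
Unset Printing Implicit Defensive.
Import Order.TTheory GRing.Theory Num.Theory.
Import numFieldNormedType.Exports.
Local Open Scope ring_scope.

Definition contains_pattern (m n : nat) (eta : 'S_m) (sigma : 'S_n) : bool :=
  [exists i : {ffun 'I_m -> 'I_n},
     [forall j : 'I_m, forall k : 'I_m, (j < k)%N ==> (i j < i k)%N] &&
     [forall j : 'I_m, forall k : 'I_m,
        (sigma (i j) < sigma (i k))%N == (eta j < eta k)%N]].

Definition Sav (m : nat) (eta : 'S_m) (n : nat) : {set 'S_n} :=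
  [set sigma : 'S_n | ~~ contains_pattern eta sigma].

Definition Pav (R : realType) (m : nat) (eta : 'S_m) (n : nat) (sigma : 'S_n) : R :=
  if sigma \in Sav eta n then (#|Sav eta n|%:R)^-1 else 0.

Definition Eav (R : realType) (m : nat) (eta : 'S_m) (n : nat) (X : 'S_n -> R) : R :=
  \sum_(sigma : 'S_n) Pav R eta sigma * X sigma.

(* False when k > n.  With l, m, x and the values all shifted by 1, the condition
   tau_i = sigma_(m+i-1) - (l-1) reads sigma (m + i) = l + tau i. *)
Definition is_cluster (k n : nat) (tau : 'S_k) (sigma : 'S_n) (l m : nat) : bool :=
  [&& (l + k <= n)%N, (m + k <= n)%N,
      [set y : 'I_n | (l <= y < l + k)%N] ==
        [set sigma x | x : 'I_n & (m <= x < m + k)%N] &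
      [forall i : 'I_k, forall x : 'I_n,
         (val x == m + i)%N ==> (val (sigma x) == l + tau i)%N]].

Definition Ntau (k n : nat) (tau : 'S_k) (sigma : 'S_n) : nat :=
  #|[set lm : 'I_n * 'I_n | is_cluster tau sigma lm.1 lm.2]|.

Definition Nk (p : nat) (eta : 'S_p) (k n : nat) (sigma : 'S_n) : nat :=
  (\sum_(tau in Sav eta k) Ntau tau sigma)%N.

Definition incr_perm (k : nat) : 'S_k := 1%g.                    (* 1 2 ... k *)
Definition decr_perm (k : nat) : 'S_k := perm (@rev_ord_inj k).  (* k ... 2 1 *)

(* Only meaningful for eta = 123 or eta = 321. *)
Definition tau_star (eta : 'S_3) (k : nat) : 'S_k :=
  if eta == incr_perm 3 then decr_perm k else incr_perm k.

Definition asymp (R : realType) (a b : nat -> R) : Prop :=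
  (a n / b n @[n --> \oo] --> (1 : R))%classic.

Definition sublinear (R : realType) (k : nat -> nat) : Prop :=
  ((fun n => (k n)%:R : R^o) =o_\oo (fun n => n%:R : R^o))%classic.

(* Main.v *)
Require Import Defs.
From mathcomp Require Import all_boot all_order all_algebra all_fingroup.
From mathcomp Require Import all_classical all_reals all_analysis.
From mathcomp Require Import zify ring lra.
Set Implicit Arguments.
Unset Strict Implicit.
Unset Printing Implicit Defensive.
Import Order.TTheory GRing.Theory Num.Theory.
Import numFieldNormedType.Exports.

(** Replacing every value v of a permutation of size n by n + 1 - v exchanges
    the patterns 123 and 321 and carries clusters to clusters, so only
    321-avoidance matters; [tau_star] then becomes the identity.

    Let A_n be the number of 321-avoiding permutations of size n, let k be the
    length of a pattern tau and put N = n - k + 1.  Contracting a cluster to a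
    point turns a 321-avoiding permutation of size n into one of size N with a
    marked point.
    - If tau is the identity, every marked point can be inflated back into an
      increasing run without creating a 321, so there are N A_N clusters in
      total ([sum_num_av321_cluster_id]).
    - Otherwise tau has an inversion.  A larger entry before the block, or a
      smaller one after it, would complete a 321; hence the permutation is a
      direct sum of a permutation of size m, of tau, and of a permutation of
      size n - k - m.  The total is the sum over m of A_m A_(n-k-m)
      ([sum_num_av321_cluster]).
    A_n is the n-th Catalan number ([num_av321_bin]), so by the Catalan
    convolution ([num_av321_convolution]) that last sum is A_N.  The expected
    number of clusters is thus exactly N A_N / A_n for [tau_star], exactly
    A_N / A_n for each of the A_k - 1 other patterns, and
    (n - k + A_k) A_N / A_n for all the patterns together.

    The recurrence (n + 2) A_(n+1) = (4n + 2) A_n makes A_n / 4^n change by a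
    factor 1 - O(1/n) at each step, so that 4^(k-1) A_N / A_n tends to 1 as
    soon as k = o(n) ([cvg_cat4_ratio]).  The total over all patterns needs in
    addition A_k ~ 4^k / (sqrt pi k^(3/2)) ([cvg_cat4_asymp]), whose constant
    comes from the Wallis integrals. *)

(** * Inversions and insertion of a point *)

Local Open Scope nat_scope.

Definition inversion n (s : 'S_n) (i j : 'I_n) : bool := (i < j) && (s j < s i).

Definition avoids321 n (s : 'S_n) : bool :=
  [forall i, forall j, forall k, inversion s i j ==> ~~ inversion s j k].

Definition num_av321 n := #|[set s : 'S_n | avoids321 s]|.

Lemma avoids321P n (s : 'S_n) :
  reflect (forall i j k, inversion s i j -> inversion s j k -> False)
          (avoids321 s).
Proof.
apply: (iffP forallP) => [H i j k ij jk|H i].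
  by move: (H i) => /forallP/(_ j)/forallP/(_ k); rewrite ij jk.
apply/forallP => j; apply/forallP => k; apply/implyP => ij.
by apply/negP => jk; apply: (H i j k).
Qed.

(** A 321 is a chain of two inversions, so any map of positions that preserves
    inversions carries the 321s of [s] to 321s of [t]; deletions, duplications
    and direct sums are all compared through this lemma. *)
Lemma avoids321_pullback n m (s : 'S_n) (t : 'S_m) (f : 'I_n -> 'I_m) :
  (forall i j, inversion s i j -> inversion t (f i) (f j)) ->
  avoids321 t -> avoids321 s.
Proof.
move=> sf /avoids321P t_av; apply/avoids321P => i j k /sf ij /sf jk.
exact: t_av ij jk.
Qed.

Lemma bump_ltn h i j : (bump h i < bump h j) = (i < j).
Proof. by rewrite !ltnNge leq_bump2. Qed.

Lemma bumpE h i : bump h i = if h <= i then i.+1 else i.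
Proof. by rewrite /bump; case: leqP. Qed.

Lemma bump_ord n (i : 'I_n) : bump n i = i.
Proof. by rewrite bumpE leqNgt ltn_ord. Qed.

Lemma inversion_lift_perm n (p q : 'I_n.+1) (s : 'S_n) i j :
  inversion (lift_perm p q s) (lift p i) (lift p j) = inversion s i j.
Proof. by rewrite /inversion !lift_perm_lift /= !bump_ltn. Qed.

Lemma avoids321_lift_perm n (p q : 'I_n.+1) (s : 'S_n) :
  avoids321 (lift_perm p q s) -> avoids321 s.
Proof.
by apply: (@avoids321_pullback _ _ _ _ (lift p)) => i j;
   rewrite inversion_lift_perm.
Qed.

Lemma lift_or_eq n (p i : 'I_n.+1) : i = p \/ exists j : 'I_n, i = lift p j.
Proof. by case: (unliftP p i) => [j|] ->; [right; exists j | left]. Qed.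

Lemma lift_perm_inj n (p q : 'I_n.+1) : injective (@lift_perm n p q).
Proof.
move=> s t st; apply/permP => i; apply: (@lift_inj _ q).
by rewrite -!(lift_perm_lift p) st.
Qed.

Lemma lift_perm_onto n (p q : 'I_n.+1) (s : 'S_n.+1) :
  s p = q -> exists t, s = lift_perm p q t.
Proof.
pose f k := odflt k (unlift q (s (lift p k))).
move=> spq.
have fK k : lift q (f k) = s (lift p k).
  have : q != s (lift p k) by rewrite -spq (inj_eq perm_inj) neq_lift.
  by rewrite /f => /unlift_some[? ? ->].
have f_inj : injective f.
  by move=> i j fij; apply/(@lift_inj _ p)/(@perm_inj _ s); rewrite -!fK fij.
exists (perm f_inj); apply/permP => k.
case: (unliftP p k) => [k'|] ->; first by rewrite lift_perm_lift -fK permE.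
by rewrite lift_perm_id.
Qed.

(** The bijection is the deletion of the point at position [p] with value
    [q]. *)
Lemma card_lift_perm n (p q : 'I_n.+1) (P : pred 'S_n.+1) :
  #|[set s | P s && (s p == q)]| = #|[set t | P (lift_perm p q t)]|.
Proof.
rewrite -(card_imset _ (@lift_perm_inj n p q)); apply: eq_card => s.
rewrite inE; apply/andP/imsetP => [[Ps /eqP /lift_perm_onto[t st]]|[t]].
  by exists t; rewrite // inE -st.
by rewrite inE => Pt ->; rewrite lift_perm_id eqxx.
Qed.

(** * Counting 321-avoiding permutations *)

(** The statistic of the recursion: a new maximum can be inserted at position
    [p] exactly when the entries from [p] onwards are increasing.  Recording an
    upper bound on where the increasing suffix starts, rather than its exact
    start, makes the counts below satisfy the Catalan triangle recurrence. *)
Definition increasing_from n (p : nat) (s : 'S_n) : bool :=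
  [forall i : 'I_n, (p <= i) ==> [forall j, ~~ inversion s i j]].

Lemma increasing_fromP n p (s : 'S_n) :
  reflect (forall i j : 'I_n, p <= i -> inversion s i j -> False)
          (increasing_from p s).
Proof.
apply: (iffP forallP) => [H i j pi ij|H i].
  by move: (H i); rewrite pi => /forallP/(_ j); rewrite ij.
apply/implyP => pi; apply/forallP => j; apply/negP; exact: H.
Qed.

Lemma no_inversion_to_max n (p i : 'I_n.+1) (s : 'S_n) :
  inversion (lift_perm p ord_max s) i p = false.
Proof.
apply/negbTE/negP; rewrite /inversion lift_perm_id => /andP[_].
by rewrite ltnNge leq_ord.
Qed.

(** A maximum at [p] exceeds everything to its right, so it starts a 321 as soon
    as there is an inversion there; it can play no other role in a 321. *)
Lemma avoids321_insert_max n (p : 'I_n.+1) (s : 'S_n) :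
  avoids321 (lift_perm p ord_max s) = avoids321 s && increasing_from p s.
Proof.
set u := lift_perm _ _ _.
have inv_max (i : 'I_n) : inversion u p (lift p i) = (p <= i).
  rewrite /inversion lift_perm_id lift_perm_lift /= bump_ord ltn_ord andbT.
  rewrite bumpE; case: (leqP p i) => pi; rewrite ?ltnS //.
  by rewrite ltnNge (ltnW pi).
apply/idP/andP => [u_av|[/avoids321P s_av /increasing_fromP s_inc]].
  split; first exact: avoids321_lift_perm u_av.
  apply/increasing_fromP => i j pi ij; move/avoids321P: u_av.
  move/(_ p (lift p i) (lift p j)); apply.
    by rewrite inv_max; exact: pi.
  by rewrite inversion_lift_perm; exact: ij.
apply/avoids321P => i j k.
case: (unliftP p j) => [j'|] ->; last by rewrite no_inversion_to_max.
case: (unliftP p k) => [k'|] ->; last by rewrite no_inversion_to_max.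
rewrite inversion_lift_perm.
case: (unliftP p i) => [i'|] ->; rewrite ?inversion_lift_perm ?inv_max.
  exact: s_av.
exact: s_inc.
Qed.

Lemma increasing_insert_max n q (p : 'I_n.+1) (s : 'S_n) : q <= n ->
  increasing_from p s ->
  increasing_from q (lift_perm p ord_max s) =
  (p < q) || (p == ord_max) && increasing_from q s.
Proof.
move=> qn /increasing_fromP p_inc; set u := lift_perm _ _ _.
case: (ltnP p q) => [pq|qp] /=.
  apply/increasing_fromP => i j.
  case: (unliftP p i) => [i'|] ->; last by rewrite leqNgt pq.
  case: (unliftP p j) => [j'|] ->; last first.
    by rewrite no_inversion_to_max.
  rewrite inversion_lift_perm /= => qi; apply: p_inc.
  by move: qi; rewrite bumpE; case: (leqP p i') => // ip qi;
    have := leq_trans ip (leq_trans (ltnW pq) qi); rewrite ltnn.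
case: eqP => [pE|pn] /=.
  rewrite /u pE; apply/increasing_fromP/increasing_fromP => q_inc i j.
    move=> qi; rewrite -(inversion_lift_perm ord_max ord_max).
    by apply: q_inc; rewrite /= bump_ord.
  case: (unliftP ord_max j) => [j'|] ->; last by rewrite no_inversion_to_max.
  case: (unliftP ord_max i) => [i'|] ->; last first.
    by move=> _; rewrite /inversion /= bump_ord => /andP[]; rewrite ltnNge ltnW.
  rewrite inversion_lift_perm /= bump_ord => qi; exact: q_inc.
apply/negbTE/negP => /increasing_fromP /(_ p (ord_max) qp); apply.
have pn' : p < n.
  by rewrite ltn_neqAle leq_ord andbT; apply/eqP => pn'; apply/pn/val_inj.
rewrite /inversion lift_perm_id pn' /=.
case: (unliftP p ord_max) => [i'|] e; last by rewrite -e /= ltnn in pn'.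
by rewrite e lift_perm_lift /= bump_ord.
Qed.

Definition num_av321_tail n p :=
  #|[set s : 'S_n | avoids321 s && increasing_from p s]|.

Lemma increasing_from_end n p (s : 'S_n) : n <= p.+1 -> increasing_from p s.
Proof.
move=> np; apply/increasing_fromP => i j pi /andP[ij _].
by have := ltn_ord j; lia.
Qed.

Lemma num_av321_tail_end n p : n <= p.+1 -> num_av321_tail n p = num_av321 n.
Proof.
by move=> np; apply: eq_card => s; rewrite !inE increasing_from_end ?andbT.
Qed.

(** Remove the maximum, at position [q].  If [q] is below [p] the remaining
    entries are only required to increase from [q]; if the maximum comes last
    they must increase from [p]; a maximum at any other [q] starts an inversion
    beyond [p]. *)
Lemma num_av321_tailS n p : p <= n ->
  num_av321_tail n.+1 p = \sum_(q < p.+1) num_av321_tail n q.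
Proof.
move=> pn; rewrite {1}/num_av321_tail -sum1_card.
rewrite (partition_big (fun s : 'S_n.+1 => (s^-1)%g ord_max) xpredT) //=.
have E (q : 'I_n.+1) :
  \sum_(s in [set s : 'S_n.+1 | avoids321 s && increasing_from p s]
        | (s^-1)%g ord_max == q) 1 =
  #|[set t : 'S_n | [&& avoids321 t, increasing_from q t &
       (q < p) || (q == ord_max) && increasing_from p t]]|.
  rewrite sum1dep_card.
  transitivity #|[set s : 'S_n.+1 |
      (avoids321 s && increasing_from p s) && (s q == ord_max)]|.
    apply: eq_card => s; rewrite !inE -(inj_eq (@perm_inj _ s)) permKV.
    by rewrite eq_sym.
  rewrite card_lift_perm; apply: eq_card => t.
  rewrite !inE avoids321_insert_max -andbA.
  case: (avoids321 t) => //=; case: (boolP (increasing_from q t)) => //= qt.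
  by rewrite increasing_insert_max.
under eq_bigr do rewrite E.
rewrite big_ord_recr [RHS]big_ord_recr /=; congr (_ + _).
  rewrite (big_ord_widen n (num_av321_tail n) pn) [RHS]big_mkcond /=.
  apply: eq_bigr => q _; case: ifP => qp.
    by apply: eq_card => t; rewrite !inE ?andbT.
  apply: eq_card0 => t; rewrite !inE [_ == ord_max]negbTE ?andbF //.
  by rewrite -val_eqE /= neq_ltn ltn_ord.
apply: eq_card => t; rewrite !inE eqxx /= ltnNge pn /=.
by rewrite increasing_from_end.
Qed.

Lemma num_av321_tail0 n : num_av321_tail n 0 = 1.
Proof.
elim: n => [|n IH]; last by rewrite num_av321_tailS // big_ord1.
rewrite num_av321_tail_end //; apply/eqP/cards1P; exists 1%g.
apply/setP => s; rewrite !inE.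
have -> : s = 1%g by apply/permP; case.
by rewrite eqxx; apply/avoids321P; case.
Qed.

(** The Catalan triangle: its entries are the ballot numbers
    C(n + p, p) - C(n + p, p - 1). *)
Lemma num_av321_tail_ballot n p : p < n ->
  num_av321_tail n p.+1 + 'C(n + p.+1, p) = 'C(n + p.+1, p.+1).
Proof.
elim: n p => [//|n IHn]; elim=> [_|p IHp pn].
  case: n IHn => [|n] IHn.
    rewrite num_av321_tail_end // -(@num_av321_tail_end 1 0) //.
    by rewrite num_av321_tail0.
  rewrite num_av321_tailS // big_ord_recr big_ord1 /= num_av321_tail0.
  have := IHn 0 isT; rewrite !bin0 !bin1; lia.
have {IHp} := IHp (ltnW pn).
have -> : n.+1 + p.+2 = (n.+1 + p.+1).+1 by rewrite addnS.
have [N eN] : exists N, N = n.+1 + p.+1 by eexists.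
rewrite -eN (binS N p.+1) (binS N p).
case: (ltnP p.+1 n) => [pn'|np].
  have := IHn p.+1 pn'; have -> : n + p.+2 = N by lia.
  have -> : num_av321_tail n.+1 p.+2
            = num_av321_tail n.+1 p.+1 + num_av321_tail n p.+2.
    by rewrite !num_av321_tailS ?big_ord_recr //=; lia.
  lia.
have {np pn} np : n = p.+1 by lia.
rewrite !num_av321_tail_end ?np //.
have : 'C(N, p.+2) = 'C(N, p.+1).
  by rewrite -(@bin_sub N p.+2); [congr 'C(_, _); lia | lia].
lia.
Qed.

Lemma num_av321_bin n : n.+1 * num_av321 n = 'C(n.*2, n).
Proof.
case: n => [|n]; first by rewrite -(@num_av321_tail_end 0 0) // num_av321_tail0.
have := num_av321_tail_ballot (ltnSn n).
rewrite num_av321_tail_end // addnn.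
have := mul_bin_left n.+1.*2 n.
have -> : n.+1.*2 - n = n.+2 by lia.
nia.
Qed.

Lemma num_av321S n : n.+2 * num_av321 n.+1 = (4 * n + 2) * num_av321 n.
Proof.
have := num_av321_bin n.+1; have := num_av321_bin n.
have := mul_bin_diag n.+1.*2 n.
have := mul_bin_diag n.*2.+1 n.
rewrite doubleS /=.
rewrite -(@bin_sub n.*2.+1 n.+1); last by lia.
have -> : n.*2.+1 - n.+1 = n by lia.
nia.
Qed.

Lemma num_av321_gt0 n : 0 < num_av321 n.
Proof.
have := num_av321_bin n; have : 0 < 'C(n.*2, n) by rewrite bin_gt0; lia.
by case: (num_av321 n) => // ; lia.
Qed.

(** An argument without generating functions.  Let S n be the convolution and
    T n the same sum weighted by the index i.  The symmetry i <-> n - i gives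
    2 T n = n S n, while the recurrence [num_av321S], summed over i, expresses
    T (n + 1) + S (n + 1) through T n and S n; the value of S (n + 1) follows
    by induction. *)
Lemma num_av321_convolution n :
  \sum_(i < n.+1) num_av321 i * num_av321 (n - i) = num_av321 n.+1.
Proof.
set A := num_av321.
pose S n := \sum_(i < n.+1) A i * A (n - i).
pose T n := \sum_(i < n.+1) i * (A i * A (n - i)).
have A0 : A 0 = 1 by have := num_av321_bin 0; rewrite -/A bin0; lia.
have TS m : 2 * T m = m * S m.
  rewrite mul2n -addnn {2}/T (reindex_inj rev_ord_inj) /= -big_split.
  rewrite big_distrr /=.
  apply: eq_bigr => i _; rewrite subSS.
  have -> : m - (m - i) = i by have := ltn_ord i; lia.
  by rewrite (mulnC (A (m - i))) -mulnDl; congr (_ * _); have := ltn_ord i; lia.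
have step m : T m.+1 + S m.+1 = A m.+1 + (4 * T m + 2 * S m).
  rewrite -big_split big_ord_recl /= subn0 mul0n A0 mul1n add0n; congr (_ + _).
  rewrite !big_distrr -big_split; apply: eq_bigr => i _ /=.
  rewrite /bump /= add1n subSS.
  by have := num_av321S i; rewrite -/A; nia.
rewrite -/(S n); elim: n => [|n IH].
  by rewrite /S big_ord1 subn0 A0; have := num_av321S 0; rewrite -/A A0; lia.
have := step n; have := TS n; have := TS n.+1; rewrite IH => e1 e2 e3.
have := num_av321S n.+1; rewrite -/A.
nia.
Qed.

(** * Clusters *)

(** As [tau] is onto, the values taken at the single positions determine the
    set of values of the block. *)
Lemma is_clusterP k n (tau : 'S_k) (sigma : 'S_n) l m :
  reflect [/\ l + k <= n, m + k <= n &
           forall (i : 'I_k) (x : 'I_n), x = m + i :> nat ->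
             sigma x = l + tau i :> nat]
          (is_cluster tau sigma l m).
Proof.
apply: (iffP and4P) => [[ln mn _ /forallP H]|[ln mn H]]; split => //.
- by move=> i x /eqP xi; move: (H i) => /forallP/(_ x)/implyP/(_ xi)/eqP.
- apply/eqP/setP => y; apply/idP/imsetP => [|[x]]; rewrite !inE => /andP[lo hi].
    have yk : y - l < k by lia.
    pose i := (tau^-1)%g (Ordinal yk).
    have mi : m + i < n by apply: leq_trans mn; rewrite ltn_add2l.
    exists (Ordinal mi); first by rewrite inE /= leq_addr ltn_add2l ltn_ord.
    by apply: val_inj; rewrite /= (H i) // permKV /= subnKC.
  have xk : x - m < k by lia.
  move=> ->; rewrite (H (Ordinal xk)) /=; last by lia.
  by rewrite leq_addr ltn_add2l ltn_ord.
- apply/forallP => i; apply/forallP => x; apply/implyP => /eqP xE.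
  exact/eqP/H.
Qed.

(** ** Clusters of the identity pattern *)

(** The insertion shifts no position and no value of the run, as all of them
    are smaller than those of the new point, which continues the run. *)
Lemma is_cluster_id_lift n k l m (p q : 'I_n.+1) (s : 'S_n) :
  p = m + k :> nat -> q = l + k :> nat ->
  is_cluster (1%g : 'S_k.+1) (lift_perm p q s) l m =
  is_cluster (1%g : 'S_k) s l m.
Proof.
move=> pE qE; apply/is_clusterP/is_clusterP => [] [ln mn H].
  split; [lia|lia|] => i x xE; rewrite perm1.
  have := H (widen_ord (leqnSn k) i) (lift p x).
  rewrite lift_perm_lift perm1 /= !bumpE xE.
  have -> : (p <= m + i) = false by rewrite pE leq_add2l leqNgt ltn_ord.
  by move=> /(_ erefl); case: leqP; have := ltn_ord i; lia.
split; [lia|lia|] => i x xE; rewrite perm1.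
case: (lift_or_eq p x) => [xE'|[x' xE']].
  by rewrite xE' lift_perm_id qE; move: xE'; move=> /(congr1 val) /=; lia.
have xx' : bump p x' = m + i by rewrite -xE xE'.
have ik : i < k.
  move: xx'; rewrite bumpE pE.
  by case: (leqP (m + k) x'); have := ltn_ord i; lia.
have := H (Ordinal ik) x'; rewrite xE' lift_perm_lift perm1 /= => ->.
  by rewrite bumpE qE leq_add2l leqNgt ik.
by move: xx'; rewrite bumpE pE; case: (leqP (m + k) x'); have := ltn_ord i; lia.
Qed.

(** The new point is a twin of the last point of the run: the two form no
    inversion with each other, and every inversion involving the new point is
    also an inversion of its twin. *)
Lemma avoids321_duplicate n k l m (p q : 'I_n.+1) (s : 'S_n) :
  p = m + k.+1 :> nat -> q = l + k.+1 :> nat ->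
  is_cluster (1%g : 'S_k.+1) s l m ->
  avoids321 (lift_perm p q s) = avoids321 s.
Proof.
move=> pE qE /is_clusterP[ln mn H].
apply/idP/idP; first exact: avoids321_lift_perm.
have p'n : m + k < n by lia.
pose p' := Ordinal p'n.
have sp' : s p' = l + k :> nat.
  by rewrite (H ord_max p') // perm1.
apply: (@avoids321_pullback _ _ _ _ (fun x => odflt p' (unlift p x))) => i j.
case: (lift_or_eq p i) => [->|[i' ->]]; case: (lift_or_eq p j) => [->|[j' ->]].
- by rewrite /inversion ltnn.
- rewrite liftK unlift_none /inversion lift_perm_lift !lift_perm_id /= !bumpE.
  rewrite sp' pE qE => /andP[ip si]; have {}ip : m + k.+1 <= j'.
    by move: ip; case: (leqP (m + k.+1) j'); lia.
  have ne : s j' <> l + k :> nat.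
    move=> se; have /perm_inj e : s j' = s p' by apply: val_inj; rewrite /= sp'.
    by move: ip; rewrite e /=; lia.
  by apply/andP; split; [lia | move: si; case: (leqP (l + k.+1) (s j')); lia].
- rewrite liftK unlift_none /inversion lift_perm_lift !lift_perm_id /= !bumpE.
  rewrite sp' pE qE => /andP[ip si]; have {}si : l + k.+1 <= s i'.
    by move: si; case: (leqP (l + k.+1) (s i')); lia.
  have ne : i' <> m + k :> nat.
    move=> ie; have e : i' = p' by apply: val_inj.
    by move: si; rewrite e sp'; lia.
  by apply/andP; split; [move: ip; case: (leqP (m + k.+1) i'); lia | lia].
- by rewrite !liftK inversion_lift_perm.
Qed.

Definition num_av321_cluster n k (tau : 'S_k) l m :=
  #|[set s : 'S_n | avoids321 s && is_cluster tau s l m]|.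

Lemma num_av321_cluster_out n k (tau : 'S_k) l m :
  ~~ ((l + k <= n) && (m + k <= n)) -> num_av321_cluster n tau l m = 0.
Proof.
move=> out; apply: eq_card0 => s; rewrite !inE; apply/negP => /andP[_].
by move=> /is_clusterP[ln mn _]; rewrite ln mn in out.
Qed.

Lemma num_av321_cluster_idS n k l m :
  num_av321_cluster n.+1 (1%g : 'S_k.+2) l m =
  num_av321_cluster n (1%g : 'S_k.+1) l m.
Proof.
case: (boolP ((l + k.+1 <= n) && (m + k.+1 <= n))) => [/andP[ln mn]|out].
  2: by rewrite !num_av321_cluster_out // !addnS !ltnS -!addnS.
have pE : (inord (m + k.+1) : 'I_n.+1) = m + k.+1 :> nat by rewrite inordK.
have qE : (inord (l + k.+1) : 'I_n.+1) = l + k.+1 :> nat by rewrite inordK.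
set p := inord _ in pE; set q := inord _ in qE.
transitivity #|[set s : 'S_n.+1 |
    (avoids321 s && is_cluster (1%g : 'S_k.+2) s l m) && (s p == q)]|.
  apply: eq_card => s; rewrite !inE.
  case: is_clusterP => [[_ _ H]|_]; rewrite ?andbF //.
  suff -> : s p == q by rewrite !andbT.
  by apply/eqP/val_inj; rewrite /= qE (H ord_max p) ?perm1 // pE.
rewrite card_lift_perm; apply: eq_card => s; rewrite !inE.
rewrite (is_cluster_id_lift _ pE qE).
case: (boolP (is_cluster _ _ _ _)) => [cl|]; rewrite ?andbF //.
by rewrite (avoids321_duplicate pE qE).
Qed.

(** Removing the run point by point reduces it to a single marked point. *)
Lemma num_av321_cluster_id n k l m :
  num_av321_cluster (n + k) (1%g : 'S_k.+1) l m =
  num_av321_cluster n (1%g : 'S_1) l m.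
Proof.
by elim: k => [|k IH]; rewrite ?addn0 // addnS num_av321_cluster_idS.
Qed.

Lemma sum_num_av321_cluster_point n :
  \sum_(l < n) \sum_(m < n) num_av321_cluster n (1%g : 'S_1) l m =
  n * num_av321 n.
Proof.
rewrite exchange_big /=.
transitivity (\sum_(m < n) num_av321 n); last by rewrite sum_nat_const card_ord.
apply: eq_bigr => m _; rewrite /num_av321 -[RHS]sum1_card.
rewrite (partition_big (fun s : 'S_n => s m) xpredT) //=.
apply: eq_bigr => l _; rewrite sum1dep_card; apply: eq_card => s; rewrite !inE.
congr (_ && _); apply/is_clusterP/eqP => [[_ _ H]|<-].
  by apply: val_inj; rewrite /= (H ord0 m) ?perm1 ?addn0.
split => [||i x]; rewrite ?addn1 // ord1 !addn0 perm1 => /val_inj ->.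
by rewrite addn0.
Qed.

Lemma sum_ord_truncate n n' (F : nat -> nat) : n' <= n ->
  (forall i, n' <= i -> F i = 0) -> \sum_(i < n) F i = \sum_(i < n') F i.
Proof.
move=> nn' F0; rewrite (big_ord_widen n F nn') [RHS]big_mkcond /=.
by apply: eq_bigr => i _; case: ltnP => // /F0.
Qed.

Lemma sum_num_av321_cluster_id n k : 0 < k <= n ->
  \sum_(l < n) \sum_(m < n) num_av321_cluster n (1%g : 'S_k) l m =
  (n - k).+1 * num_av321 (n - k).+1.
Proof.
case: k => [//|k] /= kn; rewrite subnSK //.
have [N ->] : exists N, n = N + k by exists (n - k); rewrite subnK // ltnW.
rewrite addnK.
rewrite -sum_num_av321_cluster_point (@sum_ord_truncate _ N
  (fun l => \sum_(m < N + k) num_av321_cluster (N + k) (1%g : 'S_k.+1) l m))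
  ?leq_addr //; last first.
  move=> l Nl; rewrite big1 // => m _; rewrite num_av321_cluster_id.
  by rewrite num_av321_cluster_out //; lia.
apply: eq_bigr => l _; rewrite (@sum_ord_truncate _ N
  (fun m => num_av321_cluster (N + k) (1%g : 'S_k.+1) l m)) ?leq_addr //.
  2: by move=> m Nm; rewrite num_av321_cluster_id num_av321_cluster_out //; lia.
by apply: eq_bigr => m _; rewrite num_av321_cluster_id.
Qed.

(** ** Clusters of the other patterns *)

(** A permutation [s] without inversions is increasing, and so is its inverse.
    An increasing self-map of an initial segment moves no point down; applied
    to [s] and to its inverse, this forces [s] to be the identity. *)
Lemma inversion_ex n (s : 'S_n) : s <> 1%g -> exists i j, inversion s i j.
Proof.
move=> s1; case: (boolP [exists i, exists j, inversion s i j]).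
  by move=> /existsP[i /existsP[j ij]]; exists i, j.
rewrite negb_exists => /forallP noinv; case: s1.
have mono (i j : 'I_n) : i < j -> s i < s j.
  move=> ij; move: (noinv i); rewrite negb_exists => /forallP/(_ j).
  rewrite /inversion ij /= -leqNgt leq_eqVlt.
  move=> /orP[/eqP/val_inj/perm_inj e|//].
  by rewrite e ltnn in ij.
have monoV (i j : 'I_n) : i < j -> (s^-1)%g i < (s^-1)%g j.
  move=> ij; rewrite ltnNge leq_eqVlt; apply/negP.
  move=> /orP[/eqP/val_inj/perm_inj e|].
    by rewrite e ltnn in ij.
  by move=> /mono; rewrite !permKV ltnNge (ltnW ij).
have ge (t : 'S_n) : (forall i j : 'I_n, i < j -> t i < t j) ->
    forall i : 'I_n, i <= t i.
  move=> tmono [i lti] /=; elim: i lti => [//|i IH] lti.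
  apply: leq_ltn_trans (IH (ltnW lti)) _.
  exact: (tmono (Ordinal (ltnW lti)) (Ordinal lti)).
apply/permP => i; rewrite perm1; apply/val_inj/eqP.
rewrite eqn_leq (ge s mono) andbT.
by have := ge _ monoV (s i); rewrite permK.
Qed.

Definition dsum_fun a b (f : 'I_a -> 'I_a) (g : 'I_b -> 'I_b)
    (i : 'I_(a + b)) :=
  match fintype.split i with
  | inl j => lshift b (f j)
  | inr j => rshift a (g j)
  end.

Lemma dsum_funK a b (s : 'S_a) (t : 'S_b) :
  cancel (dsum_fun s t) (dsum_fun (s^-1)%g (t^-1)%g).
Proof.
move=> i; rewrite {2}/dsum_fun; case: splitP => j ij; rewrite /dsum_fun.
  by rewrite (unsplitK (inl _)) permK; apply: val_inj.
by rewrite (unsplitK (inr _)) permK; apply: val_inj.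
Qed.

Definition dsum a b (s : 'S_a) (t : 'S_b) : 'S_(a + b) :=
  perm (can_inj (dsum_funK s t)).

Lemma dsum_lshift a b (s : 'S_a) (t : 'S_b) i :
  dsum s t (lshift b i) = lshift b (s i).
Proof. by rewrite permE /dsum_fun (unsplitK (inl _)). Qed.

Lemma dsum_rshift a b (s : 'S_a) (t : 'S_b) i :
  dsum s t (rshift a i) = rshift a (t i).
Proof. by rewrite permE /dsum_fun (unsplitK (inr _)). Qed.

Lemma shift_cases a b (i : 'I_(a + b)) :
  (exists j, i = lshift b j) \/ exists j, i = rshift a j.
Proof.
by case: (splitP i) => j ij; [left|right]; exists j; apply: val_inj.
Qed.

Lemma dsum_inj a b (s s' : 'S_a) (t t' : 'S_b) :
  dsum s t = dsum s' t' -> s = s' /\ t = t'.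
Proof.
move=> e; split; apply/permP => i.
  apply: (@lshift_inj _ b).
  by rewrite -(dsum_lshift s t) -(dsum_lshift s' t') e.
by apply: (@rshift_inj a); rewrite -(dsum_rshift s t) -(dsum_rshift s' t') e.
Qed.

(** Only the first block needs to be assumed stable: the values of the second
    block are then those left over. *)
Lemma dsum_onto a b (u : 'S_(a + b)) :
  (forall i, u (lshift b i) < a) -> exists s t, u = dsum s t.
Proof.
move=> ua.
have s_inj : injective (fun i => Ordinal (ua i)).
  by move=> i j [/val_inj/perm_inj/lshift_inj].
pose s := perm s_inj.
have sE i : lshift b (s i) = u (lshift b i) by apply: val_inj; rewrite /= permE.
have ub j : a <= u (rshift a j).
  rewrite leqNgt; apply/negP => lt.
  have : u (lshift b ((s^-1)%g (Ordinal lt))) = u (rshift a j).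
    by rewrite -sE permKV; apply: val_inj.
  move=> /perm_inj/(congr1 val) /= e.
  by have := ltn_ord ((s^-1)%g (Ordinal lt)); rewrite e ltnNge leq_addr.
have ub' j : u (rshift a j) - a < b.
  by have := ub j; have := ltn_ord (u (rshift a j)); lia.
have t_inj : injective (fun j => Ordinal (ub' j)).
  move=> i j [e]; apply/(@rshift_inj a)/(@perm_inj _ u)/val_inj => /=.
  by rewrite -(subnK (ub i)) e subnK.
exists s, (perm t_inj); apply/permP => i.
case: (shift_cases i) => [] [j ->]; first by rewrite dsum_lshift sE.
by rewrite dsum_rshift permE; apply: val_inj; rewrite /= subnKC.
Qed.

(** No inversion joins the two blocks, so a 321 lies inside one of them. *)
Lemma avoids321_dsum a b (s : 'S_a) (t : 'S_b) :
  avoids321 (dsum s t) = avoids321 s && avoids321 t.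
Proof.
have ll i j : inversion (dsum s t) (lshift b i) (lshift b j) = inversion s i j.
  by rewrite /inversion !dsum_lshift.
have rr i j : inversion (dsum s t) (rshift a i) (rshift a j) = inversion t i j.
  by rewrite /inversion !dsum_rshift /= !ltn_add2l.
have lr i j : inversion (dsum s t) (lshift b i) (rshift a j) = false.
  rewrite /inversion dsum_lshift dsum_rshift /=; apply/negbTE/negP => /andP[_].
  by have := ltn_ord (s i); lia.
have rl i j : inversion (dsum s t) (rshift a i) (lshift b j) = false.
  rewrite /inversion /=; apply/negbTE/negP => /andP[].
  by have := ltn_ord j; lia.
apply/idP/andP => [st|[/avoids321P sav /avoids321P tav]].
  by split; apply: avoids321_pullback st => i j; rewrite -?ll -?rr; exact.
apply/avoids321P => i j k.
case: (shift_cases i) => [] [i' ->]; case: (shift_cases j) => [] [j' ->];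
case: (shift_cases k) => [] [k' ->]; rewrite ?ll ?rr ?lr ?rl //.
- exact: sav.
- exact: tav.
Qed.

Lemma leq_of_perm_maps n (s : 'S_n) a b : a <= n -> b <= n ->
  (forall i : 'I_n, i < a -> s i < b) -> a <= b.
Proof.
move=> an bn ab.
have card_lt c : c <= n -> #|[set i : 'I_n | i < c]| = c.
  move=> cn; rewrite -sum1dep_card -(big_ord_widen n (fun=> 1) cn).
  by rewrite sum_nat_const card_ord muln1.
rewrite -(card_lt a) // -(card_lt b) // -(card_imset _ (@perm_inj _ s)).
apply/subset_leq_card/fintype.subsetP => y /imsetP[i]; rewrite inE => ia ->.
by rewrite inE ab.
Qed.

(** A larger entry before the block would form a 321 with an inversion of
    [tau]; an entry with a value of the block lies in the block. *)
Lemma cluster_before n k (tau : 'S_k) (s : 'S_n) l m (x : 'I_n) :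
  tau <> 1%g -> avoids321 s -> is_cluster tau s l m -> x < m -> s x < l.
Proof.
move=> /inversion_ex[i [j /andP[ij tij]]] /avoids321P s_av.
move=> /is_clusterP[ln mn H] xm.
rewrite ltnNge; apply/negP => lx.
have mn' (c : 'I_k) : m + c < n by apply: leq_trans mn; rewrite ltn_add2l.
have sE (c : 'I_k) : s (Ordinal (mn' c)) = l + tau c :> nat by apply: H.
case: (ltnP (s x) (l + k)) => [xk|kx].
  have xk' : s x - l < k by lia.
  have := sE ((tau^-1)%g (Ordinal xk')); rewrite permKV /= subnKC //.
  by move=> /val_inj/perm_inj/(congr1 val) /=; lia.
apply: (s_av x (Ordinal (mn' i)) (Ordinal (mn' j))); rewrite /inversion !sE /=.
  by apply/andP; split; [lia | have := ltn_ord (tau i); lia].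
by rewrite !ltn_add2l ij.
Qed.

Lemma cluster_after n k (tau : 'S_k) (s : 'S_n) l m (x : 'I_n) :
  tau <> 1%g -> avoids321 s -> is_cluster tau s l m ->
  m + k <= x -> l + k <= s x.
Proof.
move=> /inversion_ex[i [j /andP[ij tij]]] /avoids321P s_av.
move=> /is_clusterP[ln mn H] mx.
rewrite leqNgt; apply/negP => xk.
have mn' (c : 'I_k) : m + c < n by apply: leq_trans mn; rewrite ltn_add2l.
have sE (c : 'I_k) : s (Ordinal (mn' c)) = l + tau c :> nat by apply: H.
case: (leqP l (s x)) => [lx|xl].
  have xk' : s x - l < k by lia.
  have := sE ((tau^-1)%g (Ordinal xk')); rewrite permKV /= subnKC //.
  move=> /val_inj/perm_inj/(congr1 val) /=.
  by have := ltn_ord ((tau^-1)%g (Ordinal xk')); lia.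
apply: (s_av (Ordinal (mn' i)) (Ordinal (mn' j)) x); rewrite /inversion !sE /=.
  by rewrite !ltn_add2l ij.
by apply/andP; split; [have := ltn_ord j; lia | lia].
Qed.

(** The permutation maps the positions before the block onto the values below
    the block, so there are equally many of both. *)
Lemma cluster_diag n k (tau : 'S_k) (s : 'S_n) l m :
  tau <> 1%g -> avoids321 s -> is_cluster tau s l m -> l = m.
Proof.
move=> tau1 s_av s_cl; move/is_clusterP: (s_cl) => [ln mn H].
apply/eqP; rewrite eqn_leq; apply/andP; split; last first.
  apply: (@leq_of_perm_maps _ s); [lia | lia |] => x.
  exact: (cluster_before tau1 s_av s_cl).
apply: (@leq_of_perm_maps _ (s^-1)%g); [lia | lia |] => y yl.
rewrite ltnNge; apply/negP => mx.
have sx : s ((s^-1)%g y) = y by rewrite permKV.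
case: (ltnP ((s^-1)%g y) (m + k)) => [xk|kx].
  have xk' : (s^-1)%g y - m < k by lia.
  have := H (Ordinal xk') ((s^-1)%g y); rewrite sx /= subnKC // => /(_ erefl).
  by lia.
by have := cluster_after tau1 s_av s_cl kx; rewrite sx; lia.
Qed.

(** Splitting off the entries before the block, and then the block itself,
    exhibits the permutation as a direct sum with [tau] in the middle. *)
Lemma num_av321_cluster_diag n k r m (tau : 'S_k) : n = m + (k + r) ->
  tau <> 1%g -> avoids321 tau ->
  num_av321_cluster n tau m m = num_av321 m * num_av321 r.
Proof.
move=> -> tau1 tau_av; rewrite /num_av321_cluster.
pose f (st : 'S_m * 'S_r) := dsum st.1 (dsum tau st.2).
have f_inj : injective f.
  by move=> [s t] [s' t'] /dsum_inj[/= -> /dsum_inj[_ ->]].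
rewrite /num_av321 -cardsX -(card_imset _ f_inj).
apply: eq_card => u; rewrite inE.
apply/andP/imsetP => [[u_av u_cl]|[[s t]]]; last first.
  rewrite !inE /= => /andP[s_av t_av ->].
  rewrite /f !avoids321_dsum s_av tau_av t_av.
  split=> //; apply/is_clusterP; split; [lia | lia |] => i x xE.
  have -> : x = rshift m (lshift r i) by apply: val_inj.
  by rewrite dsum_rshift dsum_lshift.
have [s [v uE]] : exists s v, u = dsum s v.
  by apply: dsum_onto => i; apply: (cluster_before tau1 u_av u_cl) => /=.
move/is_clusterP: u_cl => [_ _ H].
have vE (i : 'I_k) : v (lshift r i) = lshift r (tau i).
  apply/(@rshift_inj m)/val_inj.
  by rewrite -(dsum_rshift s v) -uE; apply: H.
have [tau' [t vE']] : exists tau' t, v = dsum tau' t.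
  by apply: dsum_onto => i; rewrite vE /=.
have tauE : tau' = tau.
  by apply/permP => i; apply: (@lshift_inj _ r); rewrite -vE vE' dsum_lshift.
exists (s, t); last by rewrite /f /= uE vE' tauE.
by move: u_av; rewrite uE vE' !avoids321_dsum !inE => /and3P[-> _ ->].
Qed.

Lemma sum_num_av321_cluster n k (tau : 'S_k) : 0 < k <= n ->
  tau <> 1%g -> avoids321 tau ->
  \sum_(l < n) \sum_(m < n) num_av321_cluster n tau l m = num_av321 (n - k).+1.
Proof.
move=> /andP[k0 kn] tau1 tau_av; rewrite -num_av321_convolution.
have kn' : (n - k).+1 <= n by lia.
transitivity (\sum_(l < n) num_av321_cluster n tau l l).
  apply: eq_bigr => l _; rewrite (bigD1 l) //= big1 ?addn0 // => m ml.
  apply: eq_card0 => s; rewrite !inE; apply/negP => /andP[s_av s_cl].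
  by move: ml; rewrite -val_eqE /= (cluster_diag tau1 s_av s_cl) eqxx.
rewrite (@sum_ord_truncate n (n - k).+1
  (fun l => num_av321_cluster n tau l l)) //.
  apply: eq_bigr => m _; apply: num_av321_cluster_diag => //.
  by have := ltn_ord m; lia.
by move=> i ni; rewrite num_av321_cluster_out //; lia.
Qed.

Lemma sum_Ntau n k (tau : 'S_k) :
  \sum_(s : 'S_n | avoids321 s) Ntau tau s =
  \sum_(l < n) \sum_(m < n) num_av321_cluster n tau l m.
Proof.
under eq_bigr => s _ do rewrite /Ntau -sum1dep_card big_mkcond /=.
rewrite exchange_big [RHS]pair_big /=; apply: eq_bigr => lm _.
rewrite /num_av321_cluster -sum1dep_card -big_mkcondr /=.
by apply: eq_bigl => s.
Qed.

(** * The two monotone patterns *)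

Definition complement n (s : 'S_n) : 'S_n := (s * decr_perm n)%g.

Lemma complementE n (s : 'S_n) i : complement s i = n - (s i).+1 :> nat.
Proof. by rewrite permM permE. Qed.

Lemma complementK n : involutive (@complement n).
Proof.
move=> s; apply/permP => i; apply: val_inj; rewrite /= !complementE.
by have := ltn_ord (s i); lia.
Qed.

Lemma complement_ltn n (s : 'S_n) i j :
  (complement s i < complement s j) = (s j < s i).
Proof.
by rewrite !complementE; have := ltn_ord (s i); have := ltn_ord (s j); lia.
Qed.

Lemma complement1 n : complement 1%g = decr_perm n.
Proof. exact: mul1g. Qed.

Lemma contains_pattern_complement m n (eta : 'S_m) (s : 'S_n) :
  contains_pattern (complement eta) (complement s) = contains_pattern eta s.
Proof.
apply: eq_existsb => f; congr (_ && _).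
by apply/forallP/forallP => H j; apply/forallP => k;
  move: (H k) => /forallP/(_ j); rewrite !complement_ltn.
Qed.

Lemma contains_123 n (s : 'S_n) :
  contains_pattern (incr_perm 3) s = ~~ avoids321 (complement s).
Proof.
have invE i j : inversion (complement s) i j = (i < j) && (s i < s j).
  by rewrite /inversion complement_ltn.
apply/existsP/idP => [[f /andP[/forallP f_inc /forallP f_eta]]|].
  have fE (a b : 'I_3) : a < b -> inversion (complement s) (f a) (f b).
    move=> ab; rewrite invE; apply/andP; split.
      by move: (f_inc a) => /forallP/(_ b)/implyP; apply.
    by move: (f_eta a) => /forallP/(_ b)/eqP ->; rewrite !perm1.
  apply/negP => /avoids321P.
  by move/(_ (f (inord 0)) (f (inord 1)) (f (inord 2))); apply;
    apply: fE; rewrite !inordK.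
rewrite negb_forall => /existsP[i]; rewrite negb_forall => /existsP[j].
rewrite negb_forall => /existsP[k]; rewrite negb_imply negbK !invE.
move=> /andP[/andP[ij sij] /andP[jk sjk]].
exists [ffun c : 'I_3 => nth i [:: i; j; k] c].
apply/andP; split; apply/forallP => a; apply/forallP => b;
  rewrite !ffunE ?perm1.
  case: a => [[|[|[|//]]] ?]; case: b => [[|[|[|//]]] ?] //=.
  by rewrite (ltn_trans ij jk).
case: a => [[|[|[|//]]] ?]; case: b => [[|[|[|//]]] ?] //=; rewrite ?ltnn //.
- by rewrite sij.
- by rewrite (ltn_trans sij sjk).
- by rewrite ltnNge (ltnW sij).
- by rewrite sjk.
- by rewrite ltnNge (ltnW (ltn_trans sij sjk)).
- by rewrite ltnNge (ltnW sjk).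
Qed.

Lemma is_cluster_complement n k (tau : 'S_k) (s : 'S_n) l m :
  is_cluster tau s l m ->
  is_cluster (complement tau) (complement s) (n - (k + l)) m.
Proof.
move=> /is_clusterP[ln mn H]; apply/is_clusterP; split; [lia | lia |] => i x xE.
by rewrite !complementE (H i x xE); have := ltn_ord (tau i); lia.
Qed.

(** Complementing sends the least value l of a block to n - (k + l).  As it is
    an involution, an inequality valid for all permutations is enough. *)
Lemma Ntau_complement n k (tau : 'S_k) (s : 'S_n) : 0 < k ->
  Ntau (complement tau) (complement s) = Ntau tau s.
Proof.
move=> k0.
suff le (t : 'S_k) (u : 'S_n) : Ntau t u <= Ntau (complement t) (complement u).
  apply/eqP; rewrite eqn_leq le andbT.
  by have := le (complement tau) (complement s); rewrite !complementK.
have lt (l : 'I_n) : n - (k + l) < n by have := ltn_ord l; lia.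
pose f (lm : 'I_n * 'I_n) := (Ordinal (lt lm.1), lm.2).
rewrite {1}/Ntau -(@card_in_imset _ _ f) => [|[l m] [l' m']]; last first.
  rewrite !inE /= => /is_clusterP[ln _ _] /is_clusterP[ln' _ _] [e ->].
  by congr (_, _); apply: val_inj => /=; lia.
apply/subset_leq_card/fintype.subsetP => _ /imsetP[lm cl ->].
by move: cl; rewrite !inE; apply: is_cluster_complement.
Qed.

(** The reduction to 321-avoidance, which turns [tau_star eta k] into the
    identity. *)
Definition to321 (eta : 'S_3) n (s : 'S_n) : 'S_n :=
  if eta == incr_perm 3 then complement s else s.

Lemma to321_inj eta n : injective (@to321 eta n).
Proof.
by rewrite /to321 => s t; case: ifP => _ //; apply: (inv_inj (@complementK n)).
Qed.

Lemma to321_tau_star eta k : to321 eta (tau_star eta k) = 1%g.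
Proof.
rewrite /to321 /tau_star; case: (eta == _) => //.
by rewrite -complement1 complementK.
Qed.

Lemma Ntau_to321 eta n k (tau : 'S_k) (s : 'S_n) : 0 < k ->
  Ntau (to321 eta tau) (to321 eta s) = Ntau tau s.
Proof. by rewrite /to321; case: ifP => // _ k0; apply: Ntau_complement. Qed.

Lemma mem_Sav eta n (s : 'S_n) : eta = incr_perm 3 \/ eta = decr_perm 3 ->
  (s \in Sav eta n) = avoids321 (to321 eta s).
Proof.
rewrite inE /to321; case=> ->; first by rewrite eqxx contains_123 negbK.
have -> : (decr_perm 3 == incr_perm 3) = false.
  by apply/negbTE/eqP => /permP/(_ ord0)/(congr1 val); rewrite perm1 permE.
rewrite -(complementK s) -complement1 contains_pattern_complement.
by rewrite contains_123 negbK.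
Qed.

Section Totals.
Variables (eta : 'S_3) (Heta : eta = incr_perm 3 \/ eta = decr_perm 3).

Lemma card_Sav n : #|Sav eta n| = num_av321 n.
Proof.
rewrite -(card_imset _ (@to321_inj eta n)); apply: eq_card => t; rewrite !inE.
apply/imsetP/idP => [[s sS ->]|t_av]; first by rewrite -mem_Sav.
pose s := to321 eta t; have sK : to321 eta s = t.
  by rewrite /s /to321; case: (eta == _); rewrite ?complementK.
by exists s; rewrite // mem_Sav // sK.
Qed.

Lemma tau_star_in_Sav k : tau_star eta k \in Sav eta k.
Proof.
rewrite mem_Sav // to321_tau_star; apply/avoids321P => i j l /andP[ij].
by rewrite !perm1 ltnNge (ltnW ij).
Qed.

Lemma sum_Ntau_to321 n k (tau : 'S_k) : 0 < k ->
  \sum_(s in Sav eta n) Ntau tau s =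
  \sum_(l < n) \sum_(m < n) num_av321_cluster n (to321 eta tau) l m.
Proof.
move=> k0; rewrite -sum_Ntau [RHS](reindex_inj (@to321_inj eta n)) /=.
by apply: eq_big => [s|s _]; rewrite ?mem_Sav ?Ntau_to321.
Qed.

Lemma sum_Ntau_star n k : 0 < k <= n ->
  \sum_(s in Sav eta n) Ntau (tau_star eta k) s =
  (n - k).+1 * num_av321 (n - k).+1.
Proof.
move=> kn; rewrite sum_Ntau_to321; last by case/andP: kn.
by rewrite to321_tau_star sum_num_av321_cluster_id.
Qed.

Lemma sum_Ntau_other n k (tau : 'S_k) : 0 < k <= n ->
  tau \in Sav eta k -> tau <> tau_star eta k ->
  \sum_(s in Sav eta n) Ntau tau s = num_av321 (n - k).+1.
Proof.
move=> kn tauS tau_ne; rewrite sum_Ntau_to321; last by case/andP: kn.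
rewrite sum_num_av321_cluster //; last by rewrite -mem_Sav.
by rewrite -(to321_tau_star eta k) => /to321_inj.
Qed.

Lemma sum_Nk n k : 0 < k <= n ->
  \sum_(s in Sav eta n) Nk eta k s =
  (n - k + num_av321 k) * num_av321 (n - k).+1.
Proof.
move=> kn; rewrite exchange_big /= (bigD1 _ (tau_star_in_Sav k)) /=.
rewrite sum_Ntau_star //.
under eq_bigr => tau /andP[tauS /eqP tau_ne] do rewrite sum_Ntau_other //.
have : #|Sav eta k| = (\sum_(i in Sav eta k | i != tau_star eta k) 1).+1.
  by rewrite -sum1_card (bigD1 _ (tau_star_in_Sav k)) /= add1n.
rewrite card_Sav => ->.
by rewrite !sum_nat_const muln1 -mulnDl addSnnS.
Qed.
End Totals.

Local Open Scope classical_set_scope.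
Local Open Scope ring_scope.

(** * Wallis's inequalities *)

(** The primitive of sin^n that vanishes at 0, given by the reduction formula
    obtained from integration by parts; the explicit form replaces integrals by
    derivatives. *)
Fixpoint sin_primitive (R : realType) (n : nat) : R -> R :=
  match n with
  | 0 => id
  | 1 => fun x => 1 - cos x
  | m.+2 => fun x =>
      m.+2%:R^-1 * (m.+1%:R * sin_primitive m x - sin x ^+ m.+1 * cos x)
  end.

Lemma is_derive_sin_primitive (R : realType) n (x : R) :
  is_derive x 1 (@sin_primitive R n) (sin x ^+ n).
Proof.
suff : is_derive x 1 (@sin_primitive R n) (sin x ^+ n) /\
       is_derive x 1 (@sin_primitive R n.+1) (sin x ^+ n.+1) by case.
elim: n => [|n [IH IH1]]; split; try exact: IH1.
- by rewrite expr0; apply: is_derive_id.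
- have := is_deriveB (is_derive_cst (1 : R) x (1 : R)) (is_derive_cos x).
  by rewrite sub0r opprK expr1.
have -> : @sin_primitive R n.+2 = n.+2%:R^-1 *:
    ((n.+1%:R *: @sin_primitive R n : R -> R) - (@sin R) ^+ n.+1 * (@cos R))
    :> (R -> R).
  by rewrite exprfctE; apply/funext => y.
have e := is_deriveZ n.+2%:R^-1 (is_deriveB (is_deriveZ n.+1%:R IH)
  (is_deriveM (is_deriveX n.+1 (is_derive_sin x)) (is_derive_cos x))).
apply: (is_derive_eq e).
rewrite exprfctE /GRing.scale /= !exprS.
have c2 : cos x * cos x = 1 - sin x * sin x.
  by have := cos2Dsin2 x; rewrite !expr2; lra.
have n2 : n.+2%:R = n.+1%:R + 1 :> R by rewrite -natr1.
have n2_neq0 : n.+1%:R + 1 != 0 :> R by rewrite -n2 pnatr_eq0.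
rewrite [cos x * _](_ : _ = n.+1%:R * sin x ^+ n * (cos x * cos x)).
  2: by ring.
by rewrite c2 n2; field.
Qed.

Lemma sin_primitive0 (R : realType) n : @sin_primitive R n 0 = 0.
Proof.
suff : @sin_primitive R n 0 = 0 /\ @sin_primitive R n.+1 0 = 0 by case.
elim: n => [|n [IH IH1]]; split; try exact: IH1.
- by [].
- by rewrite /= cos0 subrr.
- by rewrite /= IH sin0 exprS !mul0r mulr0 subr0 mulr0.
Qed.

(** The integral of sin^n over the interval from 0 to pi / 2. *)
Definition wallis (R : realType) n : R := sin_primitive n (pi / 2).

Lemma wallis_rec (R : realType) n :
  n.+2%:R * wallis R n.+2 = n.+1%:R * wallis R n.
Proof.
by rewrite /wallis /= mulVKf ?pnatr_eq0 // cos_pihalf mulr0 subr0.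
Qed.

Lemma wallis0 (R : realType) : wallis R 0 = pi / 2.
Proof. by []. Qed.

Lemma wallis1 (R : realType) : wallis R 1 = 1.
Proof. by rewrite /wallis /= cos_pihalf subr0. Qed.

(** The reduction formula makes the left-hand side independent of [n]. *)
Lemma wallis_prod (R : realType) n :
  n.+1%:R * (wallis R n * wallis R n.+1) = pi / 2.
Proof.
elim: n => [|n IH]; first by rewrite mul1r wallis0 wallis1 mulr1.
by rewrite mulrCA wallis_rec -IH; ring.
Qed.

(** The difference of the two primitives has derivative sin^n (1 - sin), which
    is nonnegative between 0 and pi / 2. *)
Lemma wallis_le (R : realType) n : wallis R n.+1 <= wallis R n.
Proof.
rewrite -subr_ge0.
have p0 : 0 <= pi / 2 :> R by rewrite divr_ge0 // pi_ge0.
pose f : R -> R := @sin_primitive R n - @sin_primitive R n.+1.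
have df (x : R) : is_derive x (1 : R) f (sin x ^+ n - sin x ^+ n.+1).
  exact: is_deriveB (is_derive_sin_primitive n x)
                    (is_derive_sin_primitive n.+1 x).
have cf : {within `[0, pi / 2], continuous f}.
  by apply: derivable_within_continuous => z _; apply: ex_derive.
have [c] := MVT_segment p0 (fun x _ => df x) cf.
rewrite in_itv /= => /andP[c0 cp].
rewrite /f -![(_ - _ : _ -> _) _]/(_ - _) !sin_primitive0 !subr0 => ->.
rewrite mulr_ge0 // exprS -{1}[sin c ^+ n]mul1r -mulrBl.
rewrite mulr_ge0 ?subr_ge0 ?sin_le1 //.
rewrite exprn_ge0 // sin_ge0_pi // c0 (le_trans cp) //.
by rewrite ler_pdivrMr // ler_peMr ?pi_ge0 // ler1n.
Qed.

(** * Asymptotics of the Catalan numbers *)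

(** The factor of A_n that varies polynomially in n. *)
Definition cat4 (R : realType) n : R := (num_av321 n)%:R / 4 ^+ n.

Lemma cat4_gt0 (R : realType) n : 0 < cat4 R n.
Proof. by rewrite divr_gt0 ?exprn_gt0 // ltr0n num_av321_gt0. Qed.

Lemma cat4S (R : realType) n :
  (n%:R + 2) * cat4 R n.+1 = (n%:R + 2^-1) * cat4 R n.
Proof.
have := congr1 (fun m => m%:R : R) (num_av321S n).
rewrite /= !natrM -addn2 natrD [(4 * n + 2)%:R]natrD natrM => e.
rewrite /cat4 exprS.
have q0 : 4 ^+ n != 0 :> R by rewrite expf_neq0 // pnatr_eq0.
have -> : (n%:R + 2) * ((num_av321 n.+1)%:R / (4 * 4 ^+ n)) =
          (n%:R + 2) * (num_av321 n.+1)%:R / (4 * 4 ^+ n) :> R by field.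
by rewrite e; field.
Qed.

(** Both sides satisfy the same two-step recurrence. *)
Lemma wallis_cat4 (R : realType) n :
  wallis R n.*2 = pi / 2 * (n.+1%:R * cat4 R n).
Proof.
elim: n => [|n IH].
  rewrite wallis0 /cat4 expr0 divr1 mul1r.
  by have := num_av321_bin 0; rewrite bin0 mul1n => ->; rewrite mulr1.
have n2 : n.*2.+2%:R != 0 :> R by rewrite pnatr_eq0.
apply: (mulfI n2); rewrite doubleS wallis_rec IH.
have e1 : n.*2.+1%:R = 2 * n%:R + 1 :> R by rewrite -mul2n -addn1 natrD natrM.
have e2 : n.*2.+2%:R = 2 * n%:R + 2 :> R by rewrite -mul2n -addn2 natrD natrM.
have e3 : n.+1%:R = n%:R + 1 :> R by rewrite natr1.
have e4 : n.+2%:R = n%:R + 2 :> R by rewrite -natrD addn2.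
by rewrite e1 e2 e3 e4 (cat4S R n); field.
Qed.

(** Since (n + 1) A_n = C(2n, n), this is Wallis's estimate of the central
    binomial coefficient: write w_j for [wallis R j]; by [wallis_prod] the
    products (2n + 1) w_(2n) w_(2n+1) and 2n w_(2n-1) w_(2n) both equal pi / 2,
    and by monotonicity (w_(2n))^2 lies between w_(2n) w_(2n+1) and
    w_(2n-1) w_(2n). *)
Lemma cat4_sqr_bounds (R : realType) n : (0 < n)%N ->
  n%:R / (n%:R + 2^-1) <= n%:R * pi * (n.+1%:R * cat4 R n) ^+ 2 <= 1.
Proof.
case: n => // n _; set b := n.+2%:R * cat4 R n.+1.
have b0 : 0 <= b by rewrite mulr_ge0 // ltW // cat4_gt0.
have pi0 := pi_gt0 R.
have wb : wallis R n.+1.*2 = pi / 2 * b by exact: wallis_cat4.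
have nE : n.+1.*2%:R = 2 * n.+1%:R :> R by rewrite -mul2n natrM.
have n0 : 0 < n.+1%:R :> R by rewrite ltr0n.
have w0 : 0 <= wallis R n.+1.*2 by rewrite wb mulr_ge0 // divr_ge0 // ltW.
apply/andP; split.
  have lo : pi / 2 <= (2 * n.+1%:R + 1) * (pi / 2 * b) ^+ 2.
    rewrite -nE natr1 -wb -(wallis_prod R n.+1.*2) ler_pM2l ?ltr0n // expr2.
    by rewrite ler_wpM2l // wallis_le.
  rewrite ler_pdivrMr; last by lra.
  have : 1 <= (2 * n.+1%:R + 1) * (pi / 2) * b ^+ 2.
    rewrite -(ler_pM2l (x := pi / 2)); last by lra.
    rewrite mulr1 (le_trans lo) // le_eqVlt; apply/orP; left; apply/eqP.
    by ring.
  move=> h; have := ler_wpM2l (ltW n0) h; rewrite mulr1 => /le_trans; apply.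
  by rewrite le_eqVlt; apply/orP; left; apply/eqP; field.
have up : 2 * n.+1%:R * (pi / 2 * b) ^+ 2 <= pi / 2.
  rewrite -nE -wb -(wallis_prod R n.*2.+1) -doubleS ler_pM2l ?ltr0n // expr2.
  by rewrite ler_wpM2r // wallis_le.
rewrite -(ler_pM2l (x := pi / 2)); last by lra.
rewrite mulr1 (le_trans _ up) // le_eqVlt; apply/orP; left; apply/eqP.
by field.
Qed.

(** Put t = sqrt (n pi) (n + 1) [cat4] n.  By [cat4_sqr_bounds], t^2 lies
    between n / (n + 1/2) and 1; as 0 <= t <= 1, t itself lies between t^2
    and 1, and the quantity to be bounded is t n / (n + 1). *)
Lemma cat4_asymp_bounds (R : realType) n : (0 < n)%N ->
  1 - 2 / n.+1%:R <= cat4 R n * (Num.sqrt pi * n%:R `^ (3 / 2)) <= 1.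
Proof.
move=> n0; have n0' : 0 < n%:R :> R by rewrite ltr0n.
have pi0 := pi_gt0 R.
have -> : n%:R `^ (3 / 2) = n%:R * Num.sqrt n%:R :> R.
  rewrite (_ : 3 / 2 = 1 + 2^-1); last by lra.
  by rewrite powRD ?(gt_eqF n0') ?implybT // powRr1 ?powR12_sqrt ?ltW.
set t := Num.sqrt (n%:R * pi) * (n.+1%:R * cat4 R n).
have t0 : 0 <= t by rewrite !mulr_ge0 // ltW // cat4_gt0.
have n1 : n.+1%:R = n%:R + 1 :> R by rewrite natr1.
have -> : cat4 R n * (Num.sqrt pi * (n%:R * Num.sqrt n%:R)) =
          t * (n%:R / n.+1%:R).
  by rewrite /t sqrtrM ?ltW // n1; field; lra.
have : n%:R / (n%:R + 2^-1) <= t ^+ 2 <= 1.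
  have npi0 : 0 <= n%:R * pi :> R by rewrite mulr_ge0 // ltW.
  by rewrite /t exprMn sqr_sqrtr // cat4_sqr_bounds.
move=> /andP[lo up].
have t1 : t <= 1 by rewrite -(expr_le1 (n := 2)).
have tt : t ^+ 2 <= t by rewrite expr2 ler_piMl.
have q1 : n%:R / n.+1%:R = 1 - n.+1%:R^-1 :> R by rewrite n1; field; lra.
have i1 : 0 < n.+1%:R^-1 :> R by rewrite invr_gt0 ltr0n.
have q0 : 0 <= n%:R / n.+1%:R :> R by rewrite divr_ge0.
have lo' : n%:R / n.+1%:R <= n%:R / (n%:R + 2^-1) :> R.
  by rewrite n1 ler_wpM2l ?(ltW n0') // lef_pV2 ?posrE; lra.
have {}lo : n%:R / n.+1%:R <= t by rewrite (le_trans lo') // (le_trans lo).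
rewrite q1 in q0 lo *; move: (n.+1%:R^-1) i1 q0 lo => i i1 q0 lo.
apply/andP; split; last by rewrite mulr_ile1 // gerBl ltW.
by nra.
Qed.

(** By [cat4S], each step from i >= N multiplies [cat4] by
    1 - (3/2) / (i + 2), which lies between 1 - 2 / (N + 1) and 1. *)
Lemma cat4_ratio_bounds (R : realType) N j :
  cat4 R N * (1 - 2 * j%:R / N.+1%:R) <= cat4 R (N + j) <= cat4 R N.
Proof.
elim: j => [|j /andP[lo up]].
  by rewrite addn0 mulr0 mul0r subr0 mulr1 lexx.
have c0 := cat4_gt0 R N; have c0' := cat4_gt0 R (N + j).
set M : R := (N + j)%:R.
have M0 : N%:R <= M by rewrite ler_nat leq_addr.
have N0 : 0 <= N%:R :> R by [].
have E : cat4 R (N + j.+1) = cat4 R (N + j) * (1 - 3 / 2 / (M + 2)).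
  rewrite addnS; apply: (mulfI (x := M + 2)); first by lra.
  by rewrite cat4S -/M; field; lra.
have i0 : 0 < (M + 2)^-1 by rewrite invr_gt0; lra.
have i1 : (M + 2)^-1 <= N.+1%:R^-1.
  by rewrite -natr1 lef_pV2 ?posrE; lra.
have step (x c u v : R) : 0 < x -> x <= c -> 0 < u -> u <= v ->
  x * (3 / 2 * u) <= c * (2 * v) by move=> *; nra.
rewrite E; apply/andP; split.
  2: by rewrite (le_trans _ up) // ler_piMr ?(ltW c0') // gerBl; lra.
rewrite -[j.+1%:R]natr1.
have h : cat4 R (N + j) * (3 / 2 / (M + 2)) <= cat4 R N * (2 / N.+1%:R).
  exact: step.
have -> : cat4 R N * (1 - 2 * (j%:R + 1) / N.+1%:R) =
  cat4 R N * (1 - 2 * j%:R / N.+1%:R) - cat4 R N * (2 / N.+1%:R) by ring.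
by rewrite [leRHS]mulrBr mulr1 lerB.
Qed.

Lemma cvg_inv_nat (R : realType) : n%:R^-1 @[n --> \oo] --> (0 : R).
Proof.
rewrite -(cvg_shiftS (fun n => n%:R^-1 : R)); exact: cvg_harmonic.
Qed.

Section Limits.
Variables (R : realType) (k : nat -> nat).
Hypothesis k_range : \forall n \near \oo, (0 < k n <= n)%N.
Hypothesis k_small : (k n)%:R / n%:R @[n --> \oo] --> (0 : R).

Lemma cvg_cat4_ratio :
  cat4 R (n - k n).+1 / cat4 R n @[n --> \oo] --> (1 : R).
Proof.
suff h : cat4 R n / cat4 R (n - k n).+1 @[n --> \oo] --> (1 : R).
  rewrite -[1 in X in _ --> X]invr1.
  under eq_fun do rewrite -invf_div.
  by apply: cvgV => //; exact: oner_neq0.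
(* Once k n <= n / 2, the bound 2 (k n - 1) / (n - k n + 2) given by
   cat4_ratio_bounds is at most 4 (k n) / n. *)
apply: (@squeeze_cvgr _ _ _ _ (fun n => 1 - 4 * ((k n)%:R / n%:R)) (fun=> 1)).
- have k_half : \forall n \near \oo, `|0 - (k n)%:R / n%:R| <= 2^-1 :> R.
    by move/cvgrPdist_le: k_small; apply; rewrite invr_gt0.
  near=> n.
  have /andP[k0 kn] : (0 < k n <= n)%N by near: n.
  have n0 : 0 < n%:R :> R by rewrite ltr0n (leq_trans k0).
  have : `|0 - (k n)%:R / n%:R| <= 2^-1 :> R by near: n.
  rewrite sub0r normrN ger0_norm ?divr_ge0 // => kh.
  set N := (n - k n).+1.
  have nE : n = (N + (k n).-1)%N by rewrite /N; lia.
  have := cat4_ratio_bounds R N (k n).-1; rewrite -nE => /andP[lo up].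
  have cN := cat4_gt0 R N.
  apply/andP; split; last by rewrite ler_pdivrMr // mul1r.
  rewrite ler_pdivlMr // mulrC (le_trans _ lo) // ler_pM2l //.
  rewrite lerD2l lerN2.
  have kn' : (k n)%:R <= 2^-1 * n%:R :> R by rewrite -ler_pdivrMr.
  have k1 : (k n).-1%:R <= (k n)%:R :> R by rewrite ler_nat leq_pred.
  have N1 : n%:R / 2 <= N.+1%:R :> R.
    have : N.+1%:R = n%:R - (k n)%:R + 2 :> R.
      by rewrite /N -addn2 natrD natrB.
    by lra.
  rewrite ler_pdivrMr ?ltr0n //.
  have : 0 <= (k n)%:R / n%:R :> R by rewrite divr_ge0.
  have : (k n)%:R = (k n)%:R / n%:R * n%:R :> R by rewrite divfK // gt_eqF.
  nra.
- rewrite -[1 in X in _ --> X]subr0 -(mulr0 4).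
  apply: cvgB; first exact: cvg_cst.
  by apply: cvgM; [exact: cvg_cst | exact: k_small].
- exact: cvg_cst.
Unshelve. all: by end_near.
Qed.

(** The term [c] stands for the other summand of the two factors n - k + 1 and
    n - k + A_k that multiply A_(n-k+1) / A_n in the expectations. *)
Lemma cvg_sub_ratio (c : nat -> R) :
  c n / n%:R @[n --> \oo] --> (0 : R) ->
  ((n - k n)%:R + c n) / n%:R @[n --> \oo] --> (1 : R).
Proof.
move=> c0; rewrite -[1 in X in _ --> X]addr0 -[X in X + _]subr0.
apply: (@cvg_trans _ ((1 - (k n)%:R / n%:R + c n / n%:R) @[n --> \oo])).
  2: by apply: cvgD => //; apply: cvgB; [exact: cvg_cst | exact: k_small].
apply: near_eq_cvg; near=> n.
have /andP[k0 kn] : (0 < k n <= n)%N by near: n.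
have n0 : n%:R != 0 :> R by rewrite pnatr_eq0; lia.
by rewrite natrB //; field.
Unshelve. all: by end_near.
Qed.

End Limits.

Lemma cvg_cat4_asymp (R : realType) :
  cat4 R n * (Num.sqrt pi * n%:R `^ (3 / 2)) @[n --> \oo] --> (1 : R).
Proof.
apply: (@squeeze_cvgr _ _ _ _ (fun n => 1 - 2 * harmonic n) (fun=> 1)).
- by near=> n; apply: cat4_asymp_bounds; near: n; exact: nbhs_infty_gt.
- rewrite -[1 in X in _ --> X]subr0 -(mulr0 2).
  apply: cvgB; first exact: cvg_cst.
  by apply: cvgM; [exact: cvg_cst | exact: cvg_harmonic].
- exact: cvg_cst.
Unshelve. all: by end_near.
Qed.

(** The quotient is a weighted mean of [x] and [y], so it is as close to 1 as
    both of them are, whichever of the weights [u] and [v] dominates. *)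
Lemma cvg_weighted_mean (R : realType) (u v x y : nat -> R) :
  (\forall n \near \oo, 0 < u n /\ 0 < v n) ->
  x n @[n --> \oo] --> (1 : R) -> y n @[n --> \oo] --> (1 : R) ->
  (u n * x n + v n * y n) / (u n + v n) @[n --> \oo] --> (1 : R).
Proof.
move=> uv0 /cvgrPdist_le x1 /cvgrPdist_le y1; apply/cvgrPdist_le => e e0.
near=> n.
have [u0 v0] : 0 < u n /\ 0 < v n by near: n.
have xe : `|1 - x n| <= e by near: n; exact: x1.
have ye : `|1 - y n| <= e by near: n; exact: y1.
have w0 : 0 < u n + v n by exact: addr_gt0.
have -> : 1 - (u n * x n + v n * y n) / (u n + v n) =
  (u n * (1 - x n) + v n * (1 - y n)) / (u n + v n) by field; rewrite gt_eqF.
rewrite normrM normfV (gtr0_norm w0) ler_pdivrMr //.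
rewrite (le_trans (ler_normD _ _)) // !normrM (gtr0_norm u0) (gtr0_norm v0).
by rewrite mulrDr ![e * _]mulrC lerD ?ler_pM2l.
Unshelve. all: by end_near.
Qed.

Lemma sublinearP (R : realType) (k : nat -> nat) :
  sublinear R k -> (k n)%:R / n%:R @[n --> \oo] --> (0 : R).
Proof.
move=> /eqoP kn; apply/cvgrPdist_le => e e0; near=> n.
have n0 : 0 < n%:R :> R by rewrite ltr0n; near: n; exact: nbhs_infty_gt.
rewrite sub0r normrN normrM normfV ler_pdivrMr ?normr_gt0 ?gt_eqF //.
by near: n; apply: kn.
Unshelve. all: by end_near.
Qed.

(** * Expected numbers of clusters *)

Section Expectations.
Variables (R : realType) (eta : 'S_3).
Hypothesis Heta : eta = incr_perm 3 \/ eta = decr_perm 3.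

Lemma Eav_natr n (X : 'S_n -> nat) :
  Eav eta (fun s => (X s)%:R) =
  (\sum_(s in Sav eta n) X s)%N%:R / (num_av321 n)%:R :> R.
Proof.
rewrite natr_sum mulr_suml [RHS]big_mkcond /=; apply: eq_bigr => s _.
rewrite /Pav -(card_Sav Heta); case: ifP => _; last by rewrite mul0r.
by rewrite mulrC.
Qed.

(** The powers of 4 that normalise A_(n-k+1) and A_n differ by 4^(k-1). *)
Lemma num_av321_ratio n k : (0 < k <= n)%N ->
  (num_av321 (n - k).+1)%:R / (num_av321 n)%:R =
  cat4 R (n - k).+1 / cat4 R n / 4 ^+ (k - 1).
Proof.
move=> kn; have nE : n = ((n - k).+1 + (k - 1))%N by lia.
have a0 : (num_av321 n)%:R != 0 :> R by rewrite pnatr_eq0 -lt0n num_av321_gt0.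
rewrite /cat4 [4 ^+ n](_ : _ = 4 ^+ (n - k).+1 * 4 ^+ (k - 1)); last first.
  by rewrite -exprD -nE.
by field; rewrite a0 !expf_neq0 // pnatr_eq0.
Qed.

Lemma Eav_Ntau_other n k (tau : 'S_k) : (0 < k <= n)%N ->
  tau \in Sav eta k -> tau <> tau_star eta k ->
  Eav eta (fun s : 'S_n => (Ntau tau s)%:R) =
  cat4 R (n - k).+1 / cat4 R n / 4 ^+ (k - 1).
Proof.
by move=> kn tS tne; rewrite Eav_natr sum_Ntau_other // num_av321_ratio.
Qed.

Lemma Eav_Ntau_star n k : (0 < k <= n)%N ->
  Eav eta (fun s : 'S_n => (Ntau (tau_star eta k) s)%:R) =
  (n - k).+1%:R * (cat4 R (n - k).+1 / cat4 R n) / 4 ^+ (k - 1).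
Proof.
move=> kn; rewrite Eav_natr sum_Ntau_star // natrM -mulrA num_av321_ratio //.
exact: mulrA.
Qed.

Lemma Eav_Nk n k : (0 < k <= n)%N ->
  Eav eta (fun s : 'S_n => (Nk eta k s)%:R) =
  ((n - k)%:R + (num_av321 k)%:R) * (cat4 R (n - k).+1 / cat4 R n)
    / 4 ^+ (k - 1).
Proof.
move=> kn; rewrite Eav_natr sum_Nk // natrM natrD -mulrA num_av321_ratio //.
exact: mulrA.
Qed.

End Expectations.

Theorem corollary2 (R : realType) (eta : 'S_3)
    (Heta : eta = incr_perm 3 \/ eta = decr_perm 3) :
  (* (i) *)
  ((forall (k : nat) (tau : 'S_k), (2 <= k)%N ->
      tau \in Sav eta k -> tau <> tau_star eta k ->
      Eav eta (fun sigma : 'S_n => (Ntau tau sigma)%:R : R) @[n --> \oo]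
        --> (1 / 4 ^+ (k - 1) : R))
   /\
   (forall (k : nat -> nat) (tau : forall n : nat, 'S_(k n)),
      (forall n : nat, (2 <= n)%N -> (2 <= k n <= n)%N) ->
      sublinear R k ->
      (forall n : nat, (2 <= n)%N ->
         tau n \in Sav eta (k n) /\ tau n <> tau_star eta (k n)) ->
      asymp (fun n => Eav eta (fun sigma : 'S_n => (Ntau (tau n) sigma)%:R : R))
            (fun n => 1 / 4 ^+ (k n - 1))))
  /\
  (* (ii) *)
  ((forall k : nat, (2 <= k)%N ->
      1 / n%:R * Eav eta (fun sigma : 'S_n =>
                            (Ntau (tau_star eta k) sigma)%:R : R) @[n --> \oo]
        --> (1 / 4 ^+ (k - 1) : R))
   /\
   (forall k : nat -> nat,
      (forall n : nat, (2 <= n)%N -> (2 <= k n <= n)%N) ->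
      sublinear R k ->
      asymp (fun n => Eav eta (fun sigma : 'S_n =>
                                 (Ntau (tau_star eta (k n)) sigma)%:R : R))
            (fun n => n%:R / 4 ^+ (k n - 1))))
  /\
  (* (iii) *)
  ((forall k : nat, (2 <= k)%N ->
      1 / n%:R * Eav eta (fun sigma : 'S_n => (Nk eta k sigma)%:R : R) @[n --> \oo]
        --> (1 / 4 ^+ (k - 1) : R))
   /\
   (forall k : nat -> nat,
      (forall n : nat, (2 <= n)%N -> (2 <= k n <= n)%N) ->
      k n @[n --> \oo] --> \oo ->
      sublinear R k ->
      asymp (fun n => Eav eta (fun sigma : 'S_n => (Nk eta (k n) sigma)%:R : R))
            (fun n => n%:R / 4 ^+ (k n - 1)
                      + 4 / (Num.sqrt pi * (k n)%:R `^ (3 / 2))))).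
Proof.
have const_range k : (2 <= k)%N -> \forall n \near \oo, (0 < k <= n)%N.
  move=> k2; near=> n; rewrite (ltn_trans _ k2) //=.
  by near: n; exact: nbhs_infty_ge.
have const_small k : k%:R / n%:R @[n --> \oo] --> (0 : R).
  rewrite -(mulr0 k%:R); apply: cvgM; [exact: cvg_cst | exact: cvg_inv_nat].
have seq_range (k : nat -> nat) :
    (forall n : nat, (2 <= n)%N -> (2 <= k n <= n)%N) ->
    \forall n \near \oo, (0 < k n <= n)%N.
  move=> k2; near=> n.
  have /k2/andP[kn ->] : (2 <= n)%N by near: n; exact: nbhs_infty_ge.
  by rewrite andbT; lia.
have succ_ratio (k : nat -> nat) : (\forall n \near \oo, (0 < k n <= n)%N) ->
    (k n)%:R / n%:R @[n --> \oo] --> (0 : R) ->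
    (n - k n).+1%:R / n%:R * (cat4 R (n - k n).+1 / cat4 R n)
      @[n --> \oo] --> (1 : R).
  move=> kr ks; rewrite -[X in _ --> X]mulr1.
  apply: cvgM; last exact: cvg_cat4_ratio.
  under eq_fun do rewrite -natr1.
  by apply: (cvg_sub_ratio kr ks (c := fun=> 1)); exact: (const_small 1%N).
do !split.
- move=> k tau k2 tauS tau_ne.
  have kr := const_range k k2.
  have L := cvg_cat4_ratio kr (const_small k).
  apply: (@cvg_trans _ (cat4 R (n - k).+1 / cat4 R n / 4 ^+ (k - 1)
                        @[n --> \oo])).
    apply: near_eq_cvg; near=> n.
    by rewrite Eav_Ntau_other //; near: n.
  by apply: cvgM; [exact: L | exact: cvg_cst].
- move=> k tau /seq_range kr /sublinearP ks tauS.
  apply: (@cvg_trans _ (cat4 R (n - k n).+1 / cat4 R n @[n --> \oo])).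
  2: exact: cvg_cat4_ratio.
  apply: near_eq_cvg; near=> n.
  have [tS tne] : tau n \in Sav eta (k n) /\ tau n <> tau_star eta (k n).
    by apply: tauS; near: n; exact: nbhs_infty_ge.
  rewrite Eav_Ntau_other //; last by near: n.
  by rewrite div1r invrK divfK // expf_neq0 // pnatr_eq0.
- move=> k k2; have kr := const_range k k2.
  have L := succ_ratio _ kr (const_small k).
  apply: (@cvg_trans _ ((n - k).+1%:R / n%:R * (cat4 R (n - k).+1 / cat4 R n)
                        / 4 ^+ (k - 1) @[n --> \oo])).
    apply: near_eq_cvg; near=> n.
    rewrite Eav_Ntau_star //; last by near: n.
    by ring.
  by apply: cvgM; [exact: L | exact: cvg_cst].
- move=> k /seq_range kr /sublinearP ks.
  apply: (cvg_trans _ (succ_ratio k kr ks)); apply: near_eq_cvg; near=> n.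
  rewrite Eav_Ntau_star //; last by near: n.
  have n0 : n%:R != 0 :> R.
    by rewrite pnatr_eq0 -lt0n; near: n; exact: nbhs_infty_gt.
  have c0 := lt0r_neq0 (cat4_gt0 R n).
  by field; rewrite n0 c0 expf_neq0 // pnatr_eq0.
- move=> k k2; have kr := const_range k k2.
  have L := cvgM (cvg_sub_ratio kr (const_small k) (const_small (num_av321 k)))
                 (cvg_cat4_ratio kr (const_small k)).
  rewrite mulr1 in L.
  apply: (@cvg_trans _ (((n - k)%:R + (num_av321 k)%:R) / n%:R
    * (cat4 R (n - k).+1 / cat4 R n) / 4 ^+ (k - 1) @[n --> \oo])).
    apply: near_eq_cvg; near=> n.
    rewrite Eav_Nk //; last by near: n.
    by ring.
  by apply: cvgM; [exact: L | exact: cvg_cst].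
move=> k /seq_range kr koo /sublinearP ks.
(* Asymptotically, tau_star contributes u and the other patterns together
   contribute v. *)
pose u n : R := n%:R / 4 ^+ (k n - 1).
pose v n : R := 4 / (Num.sqrt pi * (k n)%:R `^ (3 / 2)).
pose rho n := cat4 R (n - k n).+1 / cat4 R n.
have pos : \forall n \near \oo, 0 < u n /\ 0 < v n.
  near=> n; have /andP[k0 kn] : (0 < k n <= n)%N by near: n.
  split; first by rewrite divr_gt0 ?exprn_gt0 // ltr0n (leq_trans k0).
  by rewrite divr_gt0 // mulr_gt0 ?sqrtr_gt0 ?pi_gt0 ?powR_gt0 // ltr0n.
have x1 : (n - k n)%:R / n%:R * rho n @[n --> \oo] --> (1 : R).
  rewrite -[X in _ --> X]mulr1; apply: cvgM; last exact: cvg_cat4_ratio.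
  under eq_fun do rewrite -[(_ - _)%:R]addr0.
  apply: (cvg_sub_ratio kr ks (c := fun=> 0)).
  by under eq_fun do rewrite mul0r; exact: cvg_cst.
have y1 : cat4 R (k n) * (Num.sqrt pi * (k n)%:R `^ (3 / 2)) * rho n
    @[n --> \oo] --> (1 : R).
  rewrite -[X in _ --> X]mulr1; apply: cvgM; last exact: cvg_cat4_ratio.
  exact: (cvg_comp _ _ koo (@cvg_cat4_asymp R)).
apply: (cvg_trans _ (cvg_weighted_mean pos x1 y1)).
apply: near_eq_cvg; near=> n.
have kn : (0 < k n <= n)%N by near: n.
rewrite Eav_Nk //; congr (_ / _); rewrite /u /v /rho.
have n0 : n%:R != 0 :> R by rewrite pnatr_eq0; lia.
have s0 : Num.sqrt pi * (k n)%:R `^ (3 / 2) != 0 :> R.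
  rewrite gt_eqF // mulr_gt0 ?sqrtr_gt0 ?pi_gt0 ?powR_gt0 // ltr0n.
  by case/andP: kn.
have -> : cat4 R (k n) = (num_av321 (k n))%:R / (4 * 4 ^+ (k n - 1)).
  by rewrite -exprS subn1 prednK //; case/andP: kn.
have q0 : 4 ^+ (k n - 1) != 0 :> R by rewrite expf_neq0 // pnatr_eq0.
have c0 := lt0r_neq0 (cat4_gt0 R n).
move: (Num.sqrt pi * _) (4 ^+ _) s0 q0 => s q s0 q0.
by field; rewrite n0 c0 q0 s0.
Unshelve. all: by end_near.
Qed.
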